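(* A polytope $\Delta$ in $M_{\mathbb R}$ is $\mathbb{Q}$-reflexive (with respect to $M$) if and only if $\Delta^*$ in $N_{\mathbb R}$ is almost reflexive (with respect to $N$). In particular, reflexive polytopes are almost reflexive.
   Context: $M$ is a lattice of rank $d$, $N=\mathrm{Hom}(M,\mathbb Z)$ its dual lattice with the natural pairing $\langle\cdot,\cdot\rangle$, $M_{\mathbb R}=M\otimes\mathbb R$, $N_{\mathbb R}=N\otimes\mathbb R$. For a subset $P\subset M_{\mathbb R}$, $P^*=\{n\in N_{\mathbb R}\mid \langle m,n\rangle\ge-1\ \forall m\in P\}$ (and symmetrically for subsets of $N_{\mathbb R}$). A $d$-dimensional polytope $\Delta\subset M_{\mathbb R}$ is $\mathbb{Q}$-reflexive (with respect to $M$) if $0\in\mathrm{int}(\Delta)$ and $\mathrm{Conv}\big((\mathrm{Conv}(\Delta\cap M))^*\cap N\big)=\Delta^*$. A $d$-dimensional lattice polytope $\Delta\subset N_{\mathbb R}$ (vertices in $N$) is almost reflexive (with respect to $N$) if $0\in\mathrm{int}(\Delta)$ and $\mathrm{Conv}\big((\mathrm{Conv}(\Delta^*\cap M))^*\cap N\big)=\Delta$. A $d$-dimensional lattice polytope $\Delta$ is reflexive if $0\in\mathrm{int}(\Delta)$ and $\Delta^*$ is also a lattice polytope (with respect to the dual lattice). All these notions are used symmetrically with $M$ and $N$ exchanged. *)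

(* Defs.v *)
From mathcomp Require Import all_boot all_order all_algebra.
From mathcomp Require Import boolp classical_sets reals topology normedtype.
From mathcomp Require Import interval_inference convex.

Set Implicit Arguments.
Unset Strict Implicit.
Unset Printing Implicit Defensive.

Import Order.TTheory GRing.Theory Num.Theory.
Import numFieldNormedType.Exports.
Import VectorInternalTheory.

Local Open Scope classical_set_scope.
Local Open Scope ring_scope.

(** A lattice of rank [d] together with its real span: [V] plays the role of
    [M_R = M (x) R], and [M] is the [Z]-span of an [R]-basis of [V]. *)
Definition is_lattice (R : realType) (V : vectType R) (d : nat) (M : set V) :
    Prop :=
  exists b : d.-tuple V,
    basis_of (fullv : {vspace V}) b /\ M = [set v | inIntSpan b v].

(** [N_R = N (x) R] is the linear dual of [V].  A homomorphism [M -> Z] extends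
    uniquely to a linear form on [V], so [N = Hom(M, Z)] is the set of linear
    forms that are integral on [M]. *)
Definition dual_lattice (R : realType) (V : vectType R) (M : set V) :
    set 'Hom(V, R^o) :=
  [set n | forall m, M m -> n m \is a @Num.int R].

(** The two orientations of the natural pairing; the notions below take either
    one, so that they apply both to subsets of [M_R] and to subsets of [N_R]. *)
Definition pairMN (R : realType) (V : vectType R) (m : V) (n : 'Hom(V, R^o)) :
    R := n m.
Definition pairNM (R : realType) (V : vectType R) (n : 'Hom(V, R^o)) (m : V) :
    R := n m.

Definition polar (R : realType) (V W : vectType R) (pr : V -> W -> R)
    (P : set V) : set W :=
  [set w | forall v, P v -> - 1 <= pr v w].

Definition conv_hull (R : realType) (V : vectType R) (A : set V) : set V :=
  smallest (@convex_set R V) A.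

(** The interior for the topology that [V], which carries none in the library,
    receives from the product topology through the linear isomorphism
    [v2r : V -> 'rV_(dim V)] (inverse [r2v]); any other linear isomorphism
    gives the same topology. *)
Definition fd_interior (R : realType) (V : vectType R) (P : set V) : set V :=
  [set v | interior ((@r2v R V) @^-1` P) (v2r v)].

(** A polytope is nonempty: this only matters for [d = 0]. *)
Definition polytope (R : realType) (V : vectType R) (P : set V) : Prop :=
  exists s : seq V, s <> [::] /\ P = conv_hull [set v | v \in s].

(** The direction of the affine hull of [P] has dimension [k]. *)
Definition has_affdim (R : realType) (V : vectType R) (k : nat) (P : set V) :
    Prop :=
  exists U : {vspace V},
    [/\ forall x y, P x -> P y -> x - y \in U,
        forall U' : {vspace V},
          (forall x y, P x -> P y -> x - y \in U') -> (U <= U')%VS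
      & \dim U = k].

Definition vertex (R : realType) (V : vectType R) (P : set V) (v : V) : Prop :=
  P v /\ forall (x y : V) (t : R), P x -> P y -> 0 < t < 1 ->
    v = t *: x + (1 - t) *: y -> x = v /\ y = v.

Definition lattice_polytope (R : realType) (V : vectType R) (L : set V)
    (P : set V) : Prop :=
  polytope P /\ forall v, vertex P v -> L v.

(** In the next three definitions [P] lives in the space [V] of the rank [d]
    lattice [L], and [L'] is the lattice dual to [L] under [pr]. *)
Definition Q_reflexive (R : realType) (V W : vectType R) (pr : V -> W -> R)
    (d : nat) (L : set V) (L' : set W) (P : set V) : Prop :=
  [/\ polytope P, has_affdim d P, fd_interior P 0
    & conv_hull (polar pr (conv_hull (P `&` L)) `&` L') = polar pr P].

Definition almost_reflexive (R : realType) (V W : vectType R)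
    (pr : V -> W -> R) (d : nat) (L : set V) (L' : set W) (P : set V) : Prop :=
  [/\ lattice_polytope L P, has_affdim d P, fd_interior P 0
    & conv_hull (polar (fun w v => pr v w)
                   (conv_hull (polar pr P `&` L')) `&` L) = P].

Definition reflexive_polytope (R : realType) (V W : vectType R)
    (pr : V -> W -> R) (d : nat) (L : set V) (L' : set W) (P : set V) : Prop :=
  [/\ lattice_polytope L P, has_affdim d P, fd_interior P 0
    & lattice_polytope L' (polar pr P)].

(* Main.v *)
Require Import Defs.
From mathcomp Require Import all_boot all_order all_algebra.
From mathcomp Require Import boolp classical_sets reals topology normedtype.
From mathcomp Require Import interval_inference convex.
From mathcomp Require Import ring lra zify.

Set Implicit Arguments.
Unset Strict Implicit.
Unset Printing Implicit Defensive.

Import Order.TTheory GRing.Theory Num.Theory.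
Import numFieldNormedType.Exports.
Import VectorInternalTheory.

Local Open Scope classical_set_scope.
Local Open Scope ring_scope.

(** The equivalence is duality plus the bipolar theorem.  Write [P'] for the
    polar of a polytope [P].  As soon as [P] contains the origin, [P''] is [P],
    and then the equations defining Q-reflexivity of [P] and almost reflexivity
    of [P'] are literally the same; what remains is to transfer the side
    conditions.

    If the origin is interior to [P], then [P'] is bounded.  The equation of
    Q-reflexivity presents [P'] as the convex hull of lattice points; there are
    only finitely many of them because a bounded part of a lattice is finite,
    so [P'] is a polytope, and its vertices are among these points.  The origin
    is interior to [P'] because [P] is bounded.

    Conversely, if [P'] is bounded then [P] contains the origin: a hyperplane
    separating the origin from [P] would put a whole ray into [P'].  Hence
    [P = P''], and the origin is interior to it as [P'] is bounded.

    For a reflexive [P], both [P] and [P'] are the convex hulls of their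
    vertices, hence of their lattice points, so the hull in the definition of
    almost reflexivity first returns [P'], and then [P'' = P].

    The geometric input is the separation of a point from a finitely generated
    convex hull ([conv_hull_separation]), a homogenized form of Farkas' lemma
    ([farkas]).  It gives the bipolar theorem ([bipolar]), the position of the
    origin ([polar_bounded_origin]), and the fact that a polytope is the hull
    of its vertices ([polytope_hull_vertices]).  Everything is stated for an
    abstract dual pairing, so that each lemma serves both orientations of the
    pairing between [V] and its dual. *)

(** * Convex hulls *)

(** Convexity is defined with coefficients bundled with a proof that they lie in
    [0, 1]; plain scalars, kept away from the trivial end points, are easier to
    produce and to consume. *)
Lemma convex_setP (R : realType) (V : vectType R) (C : set V) :
  @convex_set R V C <->
  (forall (x y : V) (t : R), C x -> C y -> 0 < t < 1 ->
     C (t *: x + (1 - t) *: y)).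
Proof.
rewrite convex_setW; split=> [cC x y t Cx Cy /andP[t0 t1]|cC x y xC yC k k0 k1].
  have := cC x y _ _ (Itv01 (ltW t0) (ltW t1)) t0 t1.
  by rewrite !inE; exact.
move: xC yC; rewrite !inE => Cx Cy.
by apply: (cC x y k%:num) => //; rewrite k0.
Qed.

Lemma conv_hull_sub (R : realType) (V : vectType R) (A : set V) :
  A `<=` conv_hull A.
Proof. exact: sub_gen_smallest. Qed.

Lemma conv_hull_min (R : realType) (V : vectType R) (A C : set V) :
  @convex_set R V C -> A `<=` C -> conv_hull A `<=` C.
Proof. exact: smallest_sub. Qed.

Lemma conv_hull_convex (R : realType) (V : vectType R) (A : set V) :
  @convex_set R V (conv_hull A).
Proof.
apply/convex_setP => x y t Ax Ay t01 C [cC AC].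
by move/convex_setP: (cC); apply; [exact: Ax|exact: Ay|].
Qed.

Lemma conv_hull_mono (R : realType) (V : vectType R) (A B : set V) :
  A `<=` B -> conv_hull A `<=` conv_hull B.
Proof.
move=> AB; apply: conv_hull_min; first exact: conv_hull_convex.
exact: subset_trans AB (@conv_hull_sub _ _ _).
Qed.

Lemma conv_hull_idem (R : realType) (V : vectType R) (C : set V) :
  @convex_set R V C -> conv_hull C = C.
Proof.
by move=> cC; apply/seteqP; split; [apply: conv_hull_min|apply: conv_hull_sub].
Qed.

Lemma conv_hull0 (R : realType) (V : vectType R) :
  conv_hull (set0 : set V) = set0.
Proof. by apply: conv_hull_idem; apply/convex_setP. Qed.

(** The total weight is not required to be one, so that the induction hypothesis
    applies to the weights of all points but the last. *)
Lemma convex_comb (R : realType) (V : vectType R) (C : set V) (n : nat)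
    (p : 'I_n -> V) (l : 'I_n -> R) :
  @convex_set R V C -> (forall i, C (p i)) -> (forall i, 0 <= l i) ->
  0 < \sum_i l i -> C ((\sum_i l i)^-1 *: \sum_i l i *: p i).
Proof.
move=> /convex_setP cC; elim: n p l => [|n IH] p l Cp l0.
  by rewrite big_ord0 ltxx.
rewrite !big_ord_recr /=.
set S := \sum_(i < n) l _; set T := \sum_(i < n) l _ *: _; set m := l _.
move=> Sm0.
have S0 : 0 <= S by apply: sumr_ge0.
have m0 : 0 <= m by exact: l0.
have [S_eq0|S_neq0] := eqVneq S 0.
  have T0 : T = 0.
    apply: big1 => i _; move/eqP: S_eq0.
    by rewrite psumr_eq0 // => /allP/(_ i (mem_index_enum i))/eqP->;
      rewrite scale0r.
  move: Sm0; rewrite S_eq0 T0 !add0r => m_gt0.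
  by rewrite scalerK ?gt_eqF //; exact: Cp.
have S_gt0 : 0 < S by rewrite lt_neqAle eq_sym S_neq0.
have CT : C (S^-1 *: T) by apply: IH.
have [m_eq0|m_neq0] := eqVneq m 0.
  by rewrite m_eq0 scale0r !addr0.
have m_gt0 : 0 < m by rewrite lt_neqAle eq_sym m_neq0.
have -> : (S + m)^-1 *: (T + m *: p ord_max) =
    (S / (S + m)) *: (S^-1 *: T) + (1 - S / (S + m)) *: p ord_max.
  rewrite scalerDr !scalerA; congr (_ *: _ + _ *: _); field.
    by rewrite S_neq0 gt_eqF.
  by rewrite gt_eqF.
apply: cC => //; rewrite divr_gt0 //= ltr_pdivrMr // mul1r; lra.
Qed.

(** * Farkas' lemma and separation *)

(** Bartl's induction on the number of forms.  If the last form [am] can be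
    dispensed with, the induction hypothesis applies at once.  Otherwise some
    [y] makes all the other forms nonnegative but [b] negative, which forces
    [am y < 0].  Projecting along [y] onto the kernel of [am] turns the problem
    into one for the remaining forms, and the sign of the data at [y] makes the
    coefficient that [am] finally receives nonnegative. *)
Lemma farkas (R : realFieldType) (X : lmodType R) (n : nat)
    (a : 'I_n -> X -> R) (b : X -> R) :
  (forall i, GRing.linear_for *%R (a i)) -> GRing.linear_for *%R b ->
  (forall x, (forall i, 0 <= a i x) -> 0 <= b x) ->
  exists2 l : 'I_n -> R, forall i, 0 <= l i &
    forall x, b x = \sum_i l i * a i x.
Proof.
elim: n a b => [|n IH] a b la lb ab.
  exists (fun=> 0) => // x; rewrite big_ord0.
  have b_ge0 y : 0 <= b y by apply: ab => -[].
  have b0 : b 0 = 0 by have := lb (-1) 0 0; rewrite scaler0 addr0; lra.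
  have := lb (-1) x 0; rewrite addr0 b0 => bN.
  have := b_ge0 (-1 *: x); have := b_ge0 x; lra.
have widenE i : widen_ord (leqnSn n) i = lift ord_max i.
  by apply: val_inj; rewrite /= /bump leqNgt ltn_ord.
pose a' i := a (lift ord_max i); pose am := a ord_max.
have la' i : GRing.linear_for *%R (a' i) by exact: la.
have lam : GRing.linear_for *%R am by exact: la.
have split_all x : (forall i, 0 <= a' i x) -> 0 <= am x -> forall i, 0 <= a i x.
  move=> a'x amx i; case: (unliftP ord_max i) => [j ->|->] //.
  exact: a'x.
have [a'b|] := pselect (forall x, (forall i, 0 <= a' i x) -> 0 <= b x).
  have [l l0 bE] := IH a' b la' lb a'b.
  exists (fun i => if unlift ord_max i is Some j then l j else 0).
    by move=> i; case: unlift.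
  move=> x; rewrite big_ord_recr /= unlift_none mul0r addr0 bE.
  by apply: eq_bigr => i _; rewrite widenE liftK.
move=> /existsNP[y /not_implyP[a'y /negP]]; rewrite -ltNge => by_lt0.
have amy_lt0 : am y < 0.
  rewrite ltNge; apply/negP => amy; move: by_lt0; rewrite ltNge => /negP; apply.
  exact/ab/split_all.
(* [proj f] is [f] composed with the projection onto the kernel of [am] along
   [y]. *)
pose k f : R := f y / am y.
pose proj (f : X -> R) x := f x - k f * am x.
have lproj f : GRing.linear_for *%R f -> GRing.linear_for *%R (proj f).
  by move=> lf c u v; rewrite /proj lf lam; ring.
have projE f x : GRing.linear_for *%R f ->
    proj f x = f (- (am x / am y) *: y + x).
  by move=> lf; rewrite lf /proj /k; field; rewrite lt_eqF.
have [|l l0 bE] := IH (fun i => proj (a' i)) (proj b)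
    (fun i => lproj _ (la' i)) (lproj _ lb).
  move=> x px; rewrite projE //; apply/ab/split_all => [i|].
    by rewrite -projE.
  rewrite lam (_ : _ + _ = 0) //; field; by rewrite lt_eqF.
pose c := k b - \sum_i l i * k (a' i).
exists (fun i => if unlift ord_max i is Some j then l j else c).
  move=> i; case: unlift => // ; rewrite /c subr_ge0.
  apply: (@le_trans _ _ 0).
    apply: sumr_le0 => j _; apply: mulr_ge0_le0 => //.
    by apply: mulr_ge0_le0; [exact: a'y|rewrite invr_le0 ltW].
  by rewrite /k -mulrNN mulr_ge0 // ?oppr_ge0 ?invr_le0 ltW.
move=> x; rewrite big_ord_recr /= unlift_none.
have -> : b x = proj b x + k b * am x by rewrite /proj; ring.
have -> : proj b x = \sum_i l i * a' i x - (\sum_i l i * k (a' i)) * am x.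
  by rewrite bE mulr_suml -sumrB; apply: eq_bigr => i _; rewrite /proj; ring.
under [in RHS]eq_bigr do rewrite widenE liftK.
by rewrite /c /k /am; ring.
Qed.

(** The symmetry of these axioms lets every lemma be used for both
    orientations. *)
Record dual_pairing (R : realType) (V W : vectType R) (pr : V -> W -> R) :
    Prop := DualPairing {
  pairing_linl : forall w, GRing.linear_for *%R (pr^~ w);
  pairing_linr : forall v, GRing.linear_for *%R (pr v);
  pairing_ndgl : forall v, (forall w, pr v w = 0) -> v = 0;
  pairing_ndgr : forall w, (forall v, pr v w = 0) -> w = 0 }.

Lemma dual_pairing_flip (R : realType) (V W : vectType R) (pr : V -> W -> R) :
  dual_pairing pr -> dual_pairing (fun w v => pr v w).
Proof. by case=> *; split. Qed.

Lemma linear_for0 (R : realType) (V : lmodType R) (f : V -> R) :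
  GRing.linear_for *%R f -> f 0 = 0.
Proof. by move=> lf; have := lf (-1) 0 0; rewrite scaler0 addr0; lra. Qed.

Lemma linear_forZ (R : realType) (V : lmodType R) (f : V -> R) c v :
  GRing.linear_for *%R f -> f (c *: v) = c * f v.
Proof.
by move=> lf; have := lf c v 0; rewrite addr0 (linear_for0 lf) addr0.
Qed.

Lemma linear_for_comb (R : realType) (V : lmodType R) (f : V -> R) n
    (l : 'I_n -> R) (p : 'I_n -> V) :
  GRing.linear_for *%R f -> f (\sum_i l i *: p i) = \sum_i l i * f (p i).
Proof.
move=> lf; elim: n l p => [|n IH] l p; first by rewrite !big_ord0 linear_for0.
by rewrite !big_ord_recl addrC -IH addrC lf.
Qed.

Lemma convex_halfspace (R : realType) (V : vectType R) (f : V -> R) c :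
  GRing.linear_for *%R f -> @convex_set R V [set v | c <= f v].
Proof.
move=> lf; apply/convex_setP => x y t /= fx fy /andP[t0 t1].
rewrite lf linear_forZ //.
by have : 0 <= t * (f x - c) + (1 - t) * (f y - c);
  [rewrite addr_ge0 // mulr_ge0 ?subr_ge0 // ltW|lra].
Qed.

(** If no such half-space exists, Farkas' lemma applies to the affine functions
    [(w, c) |-> pr u w + c] on [W * R]: the one of [v] is a nonnegative
    combination of those of [s].  Evaluating at [(0, 1)] shows that the
    coefficients sum to one, and at [(w, 0)], by nondegeneracy, that they
    express [v] in terms of [s]. *)
Lemma conv_hull_separation (R : realType) (V W : vectType R)
    (pr : V -> W -> R) (s : seq V) (v : V) :
  dual_pairing pr -> ~ conv_hull [set a | a \in s] v ->
  exists (w : W) (c : R), (forall a, a \in s -> c <= pr a w) /\ pr v w < c.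
Proof.
move=> dp vNs; apply: contrapT => noW.
pose lift (u : V) (x : W * R^o) : R := pr u x.1 + x.2.
have lin_lift u : GRing.linear_for *%R (lift u).
  by move=> c x y; rewrite /lift /= (pairing_linr dp) /= /GRing.scale /=; ring.
have [|l l0 vE] := @farkas R (W * R^o)%type (size s)
    (fun i => lift s`_i) (lift v) (fun i => lin_lift _) (lin_lift v).
  move=> [w c] lift_ge0; rewrite leNgt; apply/negP => vwc; apply: noW.
  exists w, (- c); split=> [a /(nthP 0)[i i_s <-]|].
    by have := lift_ge0 (Ordinal i_s); rewrite /lift /=; lra.
  by move: vwc; rewrite /lift /=; lra.
have l1 : \sum_i l i = 1.
  have := vE (0, 1); rewrite /lift /= (linear_for0 (pairing_linr dp v)) add0r.
  move=> ->; apply: eq_bigr => i _.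
  by rewrite (linear_for0 (pairing_linr dp _)) add0r mulr1.
have {}vE : v = \sum_i l i *: s`_i.
  apply/eqP; rewrite -subr_eq0; apply/eqP/(pairing_ndgl dp) => w.
  have := pairing_linl dp w (-1) (\sum_i l i *: s`_i) v.
  rewrite /= scaleN1r [- _ + v]addrC => ->.
  have := linear_for_comb l (fun i => s`_i) (pairing_linl dp w) => /= ->.
  have := vE (w, 0); rewrite /lift /= addr0; under eq_bigr do rewrite addr0.
  by move=> ->; ring.
apply: vNs; rewrite vE.
have := @convex_comb R V _ _ (fun i => s`_i) l
  (@conv_hull_convex _ _ [set a | a \in s]).
rewrite l1 invr1 scale1r; apply=> // i.
by apply: conv_hull_sub; apply: mem_nth.
Qed.

Lemma conv_hull_halfspace (R : realType) (V : vectType R) (f : V -> R) c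
    (A : set V) :
  GRing.linear_for *%R f -> (forall a, A a -> c <= f a) ->
  forall a, conv_hull A a -> c <= f a.
Proof. by move=> lf Ac; apply: conv_hull_min => //; apply: convex_halfspace. Qed.

(** * Polars and bounded sets *)

Lemma polar0 (R : realType) (V W : vectType R) (pr : V -> W -> R) P :
  dual_pairing pr -> polar pr P 0.
Proof. by move=> dp v _; rewrite (linear_for0 (pairing_linr dp v)); lra. Qed.

(** A hyperplane separating a point from [P] has [P], hence the origin, on its
    side, so it can be rescaled to the level [-1] that the polar imposes. *)
Lemma bipolar (R : realType) (V W : vectType R) (pr : V -> W -> R) P :
  dual_pairing pr -> polytope P -> P 0 ->
  polar (fun w v => pr v w) (polar pr P) = P.
Proof.
move=> dp [s [_ Ps]] P0; apply/seteqP; split=> [v ppv|v Pv w pw]; last exact: pw.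
rewrite Ps; apply: contrapT => /(conv_hull_separation dp)[w [c [sc vc]]].
have Pc a : P a -> c <= pr a w.
  rewrite Ps; apply: (conv_hull_halfspace (pairing_linl dp w)); exact: sc.
have c_le0 : c <= 0 by have := Pc 0 P0; rewrite (linear_for0 (pairing_linl dp w)).
(* [t] is chosen so that [-1] is the midpoint of [t * pr v w] and [t * c]. *)
pose t := 2 / - (c + pr v w).
have cv0 : 0 < - (c + pr v w) by lra.
have t0 : 0 < t by rewrite divr_gt0.
have tcv : t * c + t * pr v w = -2.
  by rewrite -mulrDr -[X in _ * X]opprK mulrN divfK ?gt_eqF.
have tvc : t * pr v w < t * c by rewrite ltr_pM2l.
have tw : polar pr P (t *: w).
  move=> a /Pc ac; rewrite linear_forZ; last exact: (pairing_linr dp).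
  have : t * c <= t * pr a w by rewrite ler_pM2l.
  by lra.
have := ppv _ tw; rewrite linear_forZ; last exact: (pairing_linr dp).
by lra.
Qed.

(** Boundedness tested on each linear form: in finite dimension this is the
    usual notion. *)
Definition bounded_wrt (R : realType) (V W : vectType R) (pr : V -> W -> R)
    (P : set V) : Prop :=
  forall w, exists C, forall v, P v -> `|pr v w| <= C.

Lemma polytope_bounded (R : realType) (V W : vectType R) (pr : V -> W -> R) P :
  dual_pairing pr -> polytope P -> bounded_wrt pr P.
Proof.
move=> dp [s [_ ->]] w; exists (\sum_(a <- s) `|pr a w|).
have s_le a : a \in s -> `|pr a w| <= \sum_(a <- s) `|pr a w|.
  by move=> a_s; rewrite (big_rem a) //= lerDl sumr_ge0.
have lf := pairing_linl dp w.
have lfN : GRing.linear_for *%R (fun v => - pr v w).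
  by move=> c x y; rewrite lf; ring.
move=> v sv; rewrite ler_norml -[X in _ && X]lerN2; apply/andP; split.
  apply: (conv_hull_halfspace lf) sv => a /s_le.
  by rewrite ler_norml => /andP[].
by apply: (conv_hull_halfspace lfN) sv => a /s_le;
  rewrite lerN2 ler_norml => /andP[].
Qed.

(** If [P] missed the origin, some form would be positive on [P] by separation;
    all its nonnegative multiples would lie in the polar, which would then be
    unbounded along any point of [P]. *)
Lemma polar_bounded_origin (R : realType) (V W : vectType R)
    (pr : V -> W -> R) P :
  dual_pairing pr -> polytope P ->
  bounded_wrt (fun w v => pr v w) (polar pr P) -> P 0.
Proof.
move=> dp [s [s0 Ps]] bP; rewrite Ps; apply: contrapT.
move=> /(conv_hull_separation dp)[w [c [sc]]].
rewrite (linear_for0 (pairing_linl dp w)) => c0.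
case: s s0 Ps sc => [//|a s] _ Ps sc.
have {bP}[C bC] := bP a.
(* This multiple exceeds the bound [C] at the point [a] of [P]. *)
pose t := (`|C| + 1) / c.
have t0 : 0 <= t by rewrite divr_ge0 // ?ltW //; have := normr_ge0 C; lra.
have tw : polar pr P (t *: w).
  move=> x Px; rewrite linear_forZ; last exact: (pairing_linr dp).
  have : c <= pr x w.
    by move: Px; rewrite Ps; apply: (conv_hull_halfspace (pairing_linl dp w)).
  move=> cx; apply: (@le_trans _ _ 0); first by lra.
  by rewrite mulr_ge0 //; lra.
have := bC _ tw; rewrite linear_forZ; last exact: (pairing_linr dp).
have ca : c <= pr a w by apply: sc; rewrite inE eqxx.
have : `|C| + 1 <= t * pr a w.
  by rewrite -[X in X <= _](divfK (lt0r_neq0 c0)) -/t ler_wpM2l.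
by have := ler_norm (t * pr a w); have := ler_norm C; lra.
Qed.

(** An interior origin bounds the polar and fixes the affine dimension through
    this consequence alone: the set absorbs every vector. *)
Lemma fd_interior_absorbing (R : realType) (V : vectType R) (P : set V) v :
  fd_interior P 0 -> exists2 e, 0 < e & P (e *: v).
Proof.
rewrite /fd_interior /= linear0 => /nbhs_ballP[e /= e0 eP].
pose k := `|v2r v| + 1.
have k0 : 0 < k by rewrite /k; have := normr_ge0 (v2r v); lra.
have ek0 : 0 < e / k by rewrite divr_gt0.
exists (e / k) => //.
have := eP (e / k *: v2r v); rewrite /= linearZ /= v2rK; apply.
rewrite -ball_normE /ball_ /= sub0r normrN normrZ gtr0_norm //.
by rewrite mulrAC ltr_pdivrMr // ltr_pM2l // /k; lra.
Qed.

Lemma fd_interior0 (R : realType) (V : vectType R) (P : set V) :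
  fd_interior P 0 -> P 0.
Proof. by move/(fd_interior_absorbing 0) => [e _]; rewrite scaler0. Qed.

(** [P] contains positive multiples of both [v] and [- v], each of which bounds
    [pr v] on the polar from one side. *)
Lemma polar_bounded (R : realType) (V W : vectType R) (pr : V -> W -> R) P :
  dual_pairing pr -> fd_interior P 0 ->
  bounded_wrt (fun w v => pr v w) (polar pr P).
Proof.
move=> dp iP v.
have [e e0 Pe] := fd_interior_absorbing v iP.
have [e' e'0 Pe'] := fd_interior_absorbing (- v) iP.
exists (e^-1 + e'^-1) => w pw.
have := pw _ Pe; have := pw _ Pe'.
have lf := pairing_linl dp w.
rewrite -[- v]scaleN1r scalerA (linear_forZ _ _ lf) (linear_forZ _ _ lf).
rewrite mulrN1 mulNr lerN2 -ler_pdivlMl // mulr1 -ler_pdivrMl // mulrN1 => h h'.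
have := ltW e0; have := ltW e'0; rewrite -invr_ge0 -[0 <= e]invr_ge0 => *.
by rewrite ler_norml; lra.
Qed.

(** A vector whose coordinates are all small pairs to at most one in absolute
    value with the points of [P], since [P] is bounded along each of the
    finitely many coordinate vectors. *)
Lemma polar_interior (R : realType) (V W : vectType R) (pr : V -> W -> R) P :
  dual_pairing pr -> bounded_wrt pr P -> fd_interior (polar pr P) 0.
Proof.
move=> dp bP; pose e_ j : W := r2v (delta_mx 0 j).
have /choice[C bC] : forall j, exists C, forall v, P v -> `|pr v (e_ j)| <= C.
  by move=> j; exact: bP.
pose B := 1 + \sum_j `|C j|.
have B0 : 0 < B by rewrite /B; have : 0 <= \sum_j `|C j| by [apply: sumr_ge0]; lra.
rewrite /fd_interior /= linear0; apply/nbhs_ballP; exists B^-1.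
  by rewrite /= invr_gt0.
move=> x [_ xB] v Pv.
have -> : pr v (r2v x) = \sum_j x 0 j * pr v (e_ j).
  rewrite {1}[x]row_sum_delta linear_sum /=.
  under eq_bigr do rewrite linearZ /=.
  exact: (linear_for_comb (x 0) e_ (pairing_linr dp v)).
have : `|\sum_j x 0 j * pr v (e_ j)| <= \sum_j B^-1 * `|C j|.
  apply: le_trans (ler_norm_sum _ _ _) _; apply: ler_sum => j _.
  rewrite normrM ler_pM //.
    by have := xB 0 j; rewrite -ball_normE /ball_ /= mxE sub0r normrN => /ltW.
  exact: le_trans (bC j v Pv) (ler_norm _).
rewrite -mulr_sumr => xC.
have : B^-1 * \sum_j `|C j| <= 1 by rewrite mulrC ler_pdivrMr // /B; lra.
by move: xC; rewrite ler_norml => /andP[]; lra.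
Qed.

Lemma fd_interior_affdim (R : realType) (V : vectType R) (P : set V) :
  fd_interior P 0 -> has_affdim (dim V) P.
Proof.
move=> iP; exists fullv; split=> [x y _ _||]; [exact: memvf| |exact: dimvf].
move=> U PU; apply/subvP => v _.
have [e e0 Pe] := fd_interior_absorbing v iP.
have := PU _ _ Pe (fd_interior0 iP); rewrite subr0 => eU.
by rewrite -[v](scalerK (lt0r_neq0 e0)) rpredZ.
Qed.

(** * Vertices *)

(** Removing an extreme point from a convex set leaves a convex set; if the
    vertex were not in [A], this smaller set would still contain [A]. *)
Lemma vertex_conv_hull (R : realType) (V : vectType R) (A : set V) v :
  vertex (conv_hull A) v -> A v.
Proof.
move=> [hv ext]; apply: contrapT => nAv.
pose C := [set x | conv_hull A x /\ x <> v].
suff : conv_hull A `<=` C by move/(_ _ hv) => -[].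
apply: conv_hull_min => [|x Ax]; last first.
  by split; [exact: conv_hull_sub|move=> xv; apply: nAv; rewrite -xv].
apply/convex_setP => x y t [hx xv] [hy yv] t01; split.
  by have /convex_setP := @conv_hull_convex _ _ A; exact.
by move/esym/(ext _ _ _ hx hy t01) => -[].
Qed.

(** A functional separating [a] from the hull of the other points attains its
    minimum over the hull of [s] at [a] only, so [a] is an exposed point. *)
Lemma vertex_of_notin_hull (R : realType) (V W : vectType R)
    (pr : V -> W -> R) (s : seq V) a :
  dual_pairing pr -> a \in s ->
  ~ conv_hull [set x | x \in [seq x <- s | x != a]] a ->
  vertex (conv_hull [set x | x \in s]) a.
Proof.
move=> dp a_s /(conv_hull_separation dp)[w [c [sc ac]]].
pose f x := pr x w; have lf : GRing.linear_for *%R f := pairing_linl dp w.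
pose C := [set x | x = a \/ f a < f x].
have sC : conv_hull [set x | x \in s] `<=` C.
  apply: conv_hull_min => [|x /= x_s]; last first.
    have [->|xa] := eqVneq x a; [by left|right].
    by apply: lt_le_trans ac _; apply: sc; rewrite mem_filter xa.
  apply/convex_setP => x y t Cx Cy /andP[t0 t1].
  rewrite /C /= lf (linear_forZ _ _ lf).
  have t1' : 0 < 1 - t by lra.
  case: Cx Cy => [->|ax] [->|ay].
  - by left; rewrite -scalerDl addrC subrK scale1r.
  - by right; have : 0 < (1 - t) * (f y - f a) by [rewrite mulr_gt0 ?subr_gt0]; lra.
  - by right; have : 0 < t * (f x - f a) by [rewrite mulr_gt0 ?subr_gt0]; lra.
  - right; have : 0 < t * (f x - f a) by rewrite mulr_gt0 ?subr_gt0.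
    by have : 0 < (1 - t) * (f y - f a) by [rewrite mulr_gt0 ?subr_gt0]; lra.
split; first exact: conv_hull_sub.
move=> x y t /sC Cx /sC Cy /andP[t0 t1] aE.
have faE : t * (f x - f a) + (1 - t) * (f y - f a) = 0.
  by have := congr1 f aE; rewrite lf (linear_forZ _ _ lf); lra.
have t1' : 0 < 1 - t by lra.
have pos z r : 0 < r -> f a < f z -> 0 < r * (f z - f a).
  by move=> r0 az; rewrite mulr_gt0 ?subr_gt0.
case: Cx Cy => [xa|/(pos _ _ t0) ax] [ya|/(pos _ _ t1') ay]; first by [].
- by move: faE; rewrite xa subrr mulr0 add0r => h; rewrite h ltxx in ay.
- by move: faE; rewrite ya subrr mulr0 addr0 => h; rewrite h ltxx in ax.
- by have := addr_gt0 ax ay; rewrite faE ltxx.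
Qed.

(** A generator that is not a vertex lies in the hull of the others and can be
    discarded; this process ends with generators that are all vertices. *)
Lemma polytope_hull_vertices (R : realType) (V W : vectType R)
    (pr : V -> W -> R) (P : set V) :
  dual_pairing pr -> polytope P -> P `<=` conv_hull (vertex P).
Proof.
move=> dp [s [_ ->]].
have [n] := ubnP (size s); elim: n s => // n IH s; rewrite ltnS => sn.
have [s_vert|] := pselect (forall a, a \in s -> vertex (conv_hull [set x | x \in s]) a).
  exact: conv_hull_mono.
move=> /existsNP[a /not_implyP[a_s a_nvert]].
have a_hull : conv_hull [set x | x \in [seq x <- s | x != a]] a.
  by apply: contrapT => /(vertex_of_notin_hull dp a_s).
have <- : conv_hull [set x | x \in [seq x <- s | x != a]] =
    conv_hull [set x | x \in s].
  apply/seteqP; split.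
    by apply: conv_hull_mono => x /=; rewrite mem_filter => /andP[].
  apply: conv_hull_min => [|x /= x_s]; first exact: conv_hull_convex.
  have [->//|xa] := eqVneq x a.
  by apply: conv_hull_sub; rewrite /= mem_filter xa.
apply: IH; rewrite size_filter (leq_trans _ sn) // -(count_predC (pred1 a) s).
by rewrite -[X in (X < _)%N]add0n ltn_add2r -has_count has_pred1.
Qed.

(** * Lattice points *)

Lemma lattice_basis_mem (R : realType) (V : vectType R) d (b : d.-tuple V)
    (i : 'I_d) : inIntSpan b b`_i.
Proof.
exists [ffun j => (j == i)%:Z]; rewrite (bigD1 i) //= ffunE eqxx mulr1z.
by rewrite big1 ?addr0 // => j /negPf ji; rewrite ffunE ji mulr0z.
Qed.

(** An element of the dual lattice is determined by its values on a basis of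
    the lattice, and these are integers in a bounded range. *)
Lemma dual_lattice_bounded_finite (R : realType) (V : vectType R) d (M : set V)
    (A : set 'Hom(V, R^o)) :
  is_lattice d M -> A `<=` dual_lattice M -> bounded_wrt (@pairNM R V) A ->
  exists s : seq 'Hom(V, R^o), A = [set n | n \in s].
Proof.
move=> [b [b_basis ->]] AN bA.
have /choice[C bC] : forall i : 'I_d, exists C, forall n, A n -> `|n b`_i| <= C.
  by move=> i; have [C HC] := bA b`_i; exists C.
pose K := (\sum_i Num.bound `|C i|)%N.
have CK i : C i <= K%:R.
  apply: le_trans (ler_norm _) _; apply: ltW.
  apply: (lt_le_trans (archi_boundP (normr_ge0 _))).
  by rewrite ler_nat /K (bigD1 i) //= leq_addr.
(* Values lie in [-K, K]; shifted by [K] they become ordinals below [2K+1]. *)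
pose codes (k : {ffun 'I_d -> 'I_(K + K).+1}) (n : 'Hom(V, R^o)) :=
  forall i : 'I_d, n b`_i = (k i)%:R - K%:R.
have codes_inj k n n' : codes k n -> codes k n' -> n = n'.
  move=> kn kn'; apply/lfunP => v.
  rewrite (coord_basis b_basis (memvf v)) !linear_sum /=.
  by apply: eq_bigr => i _; rewrite !linearZ /= kn kn'.
have codes_ex n : A n -> exists k, codes k n.
  move=> An; have /choice[z zE] : forall i : 'I_d, exists z, n b`_i = z%:~R :> R.
    by move=> i; apply/intrP/(AN n An)/lattice_basis_mem.
  have zK i : (0 <= z i + K%:Z)%R && (z i + K%:Z <= (K + K)%:Z).
    have := le_trans (bC i n An) (CK i).
    rewrite zE ler_norml [K%:R]pmulrn -mulrNz !ler_int PoszD.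
    by case/andP => ? ?; apply/andP; split; lia.
  exists [ffun i => inord `|(z i + K%:Z)%R|%N] => i.
  have /andP[z0 zKK] := zK i.
  rewrite ffunE inordK ?ltnS -?lez_nat ?gez0_abs //.
  by rewrite zE [_%:R]pmulrn gez0_abs // intrD addrK.
pose g k := xget (0 : 'Hom(V, R^o)) [set n | A n /\ codes k n].
exists [seq n <- [seq g k | k : {ffun 'I_d -> 'I_(K + K).+1}] | `[< A n >]].
apply/seteqP; split=> n /=; rewrite mem_filter; [move=> An|by case/andP => /asboolP].
apply/andP; split; first exact/asboolP.
have [k kn] := codes_ex n An.
have [_ kg] : [set n | A n /\ codes k n] (g k) by apply: xgetPex; exists n.
by rewrite (codes_inj _ _ _ kn kg) codom_f.
Qed.

(** * Reflexivity *)

Lemma lattice_polytope_hull (R : realType) (V W : vectType R)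
    (pr : V -> W -> R) (L P : set V) :
  dual_pairing pr -> lattice_polytope L P -> conv_hull (P `&` L) = P.
Proof.
move=> dp [pP vL]; apply/seteqP; split.
  have [s [_ ->]] := pP.
  by apply: conv_hull_min => [|x []//]; exact: conv_hull_convex.
apply: subset_trans (polytope_hull_vertices dp pP) _.
by apply: conv_hull_mono => v /[dup] /vL Lv [].
Qed.

Lemma reflexive_almost_reflexive (R : realType) (V W : vectType R)
    (pr : V -> W -> R) d (L : set V) (L' : set W) (P : set V) :
  dual_pairing pr -> reflexive_polytope pr d L L' P ->
  almost_reflexive pr d L L' P.
Proof.
move=> dp [latP dimP intP lat'P]; split=> //.
rewrite (lattice_polytope_hull (dual_pairing_flip dp) lat'P).
rewrite (bipolar dp latP.1 (fd_interior0 intP)).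
exact: lattice_polytope_hull dp latP.
Qed.

(** The arithmetic of the lattice enters only through the finiteness of its
    bounded subsets, which makes the polar of a Q-reflexive polytope a
    polytope. *)
Lemma Q_reflexive_polar (R : realType) (V W : vectType R)
    (pr : V -> W -> R) (L : set V) (L' : set W) (P : set V) :
  dual_pairing pr -> dim V = dim W ->
  (forall A, A `<=` L' -> bounded_wrt (fun w v => pr v w) A ->
     exists s : seq W, A = [set w | w \in s]) ->
  polytope P ->
  Q_reflexive pr (dim V) L L' P <->
  almost_reflexive (fun w v => pr v w) (dim V) L' L (polar pr P).
Proof.
move=> dp dimE finL' pP; have dp' := dual_pairing_flip dp.
split=> [[_ _ iP hullE]|[[pP' _] _ _ hullE]].
  have P0 := fd_interior0 iP.
  have iP' : fd_interior (polar pr P) 0.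
    exact: polar_interior (polytope_bounded dp pP).
  split=> //.
  - split; rewrite -hullE; last by move=> v /vertex_conv_hull[].
    set A := _ `&` L' in hullE *.
    have [s As] : exists s : seq W, A = [set w | w \in s].
      apply: finL' => [w []//|v].
      have [C bC] := polar_bounded dp iP v; exists C => w Aw.
      by apply: bC; rewrite -hullE; exact: conv_hull_sub.
    exists s; split; last by rewrite As.
    move=> s0; have : conv_hull A 0 by rewrite hullE; exact: polar0.
    suff -> : A = set0 by rewrite conv_hull0.
    by rewrite As s0; apply/seteqP; split.
  - by rewrite dimE; exact: fd_interior_affdim.
  - by rewrite (bipolar dp pP P0).
have bP' := polytope_bounded dp' pP'.
have P0 := polar_bounded_origin dp pP bP'.
have bip := bipolar dp pP P0.
have iP : fd_interior P 0 by rewrite -bip; exact: polar_interior bP'.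
by split=> //; [exact: fd_interior_affdim|rewrite bip in hullE].
Qed.

Lemma dual_pairing_eval (R : realType) (V : vectType R) :
  dual_pairing (@pairMN R V).
Proof.
split=> [n c u v|v c m n|v v0|n n0]; rewrite /pairMN ?linearP //.
- by rewrite add_lfunE scale_lfunE.
- rewrite (coord_vbasis (memvf v)) big1 // => i _.
  have := v0 (linfun (coord (vbasis fullv) i)).
  by rewrite /pairMN lfunE /= => ->; rewrite scale0r.
- by apply/lfunP => v; rewrite zero_lfunE; exact: n0.
Qed.

Theorem lemma1p11 (R : realType) (d : nat) (V : vectType R) (M : set V)
    (HM : is_lattice d M) :
  (forall Delta : set V, polytope Delta ->
     (Q_reflexive (@pairMN R V) d M (dual_lattice M) Delta <->
      almost_reflexive (@pairNM R V) d (dual_lattice M) M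
        (polar (@pairMN R V) Delta))) /\
  (forall Delta : set V,
     reflexive_polytope (@pairMN R V) d M (dual_lattice M) Delta ->
     almost_reflexive (@pairMN R V) d M (dual_lattice M) Delta) /\
  (forall Delta : set 'Hom(V, R^o)%type,
     reflexive_polytope (@pairNM R V) d (dual_lattice M) M Delta ->
     almost_reflexive (@pairNM R V) d (dual_lattice M) M Delta).
Proof.
have dp := dual_pairing_eval V.
have dimV : dim V = d.
  by have [b [/size_basis bE _]] := HM; rewrite -dimvf bE.
split; [|split].
- move=> Delta pD; rewrite -dimV.
  apply: Q_reflexive_polar (dp) _ _ pD; first by rewrite /dim /= muln1.
  by move=> A; exact: dual_lattice_bounded_finite HM.
- by move=> Delta; exact: reflexive_almost_reflexive.
- by move=> Delta; exact/reflexive_almost_reflexive/(dual_pairing_flip dp).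
Qed.
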